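(* Let $\lambda>0$, $\xi>0$, $v_2<v_1$ with either $v_2<0<v_1$ or $0<v_2<v_1$, $q\in[0,1]$, and let $\tilde X(t)$ be the position of the extended telegraph process driven by GCPs with parameter $\lambda$ with Poissonian resets to the origin at rate $\xi$, with $\tilde X(0)=0$ and random initial velocity $V(0)=V_0$ where $P\{V_0=v_1\}=q$, $P\{V_0=v_2\}=1-q$. Then for $t>0$ and $v_2t<x<v_1t$ its (generalized) density $\tilde p(x,t)$ equals $$ \tilde p(x,t)=qH_1(x,t)+(1-q)H_2(x,t)+\mathbb 1_{\{v_2t<x<v_1t\}}\frac{\lambda e^{-\xi t}}{(v_1-v_2)(1+\lambda t)}+\frac{\xi e^{\xi/\lambda}}{v_1-v_2}\boldsymbol I(x,t)\Gamma_\lambda^\xi(x,t), $$ where $H_j(x,t)=\frac{e^{-\xi t}\delta(x-v_jt)}{1+\lambda t}+\mathrm{sgn}(v_j)\mathbb 1_{\{0<\frac{x}{v_j}<t\}}\frac{\xi e^{-\xi x/v_j}}{v_j+\lambda x}$, $j=1,2$.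
   Context: GCP with intensity $\lambda>0$: a Poisson process whose rate is random, exponentially distributed with mean $\lambda$; increments satisfy $P\{\tilde N_\lambda(t+s)-\tilde N_\lambda(t)=k\}=\frac{1}{1+\lambda s}(\frac{\lambda s}{1+\lambda s})^k$. The process: a particle starts at the origin with initial velocity $V(0)$ ($v_1,v_2\neq0$, $v_2<v_1$), moves with velocity alternating between $v_1$ and $v_2$, the periods at velocity $v_1$ and at $v_2$ being governed by two independent GCPs of intensity $\lambda$; additionally it is instantaneously reset to the origin at the epochs of an independent Poisson process of rate $\xi$, restarting afresh with its initial velocity. Conditional on $V(0)=v_j$, the density is $\tilde p(x,t|v_j)=e^{-\xi t}p(x,t|v_j)+\xi\int_0^te^{-\xi s}p(x,s|v_j)ds$, where $p(x,t|v_j)=\frac{\delta(x-v_jt)}{1+\lambda t}+\mathbb 1_{\{v_2t<x<v_1t\}}\frac{\lambda}{(v_1-v_2)(1+\lambda t)}$ ($\delta$ Dirac delta); with random initial velocity, $\tilde p(x,t)=q\tilde p(x,t|v_1)+(1-q)\tilde p(x,t|v_2)$. Notation: $M_x=\max\{x/v_1,x/v_2\}$, $m_{x,t}=\min\{x/v_2,t\}$; $\Gamma(a,z_0,z_1)=\int_{z_0}^{z_1}s^{a-1}e^{-s}ds$; $\Gamma_\lambda^\xi(x,t)=\Gamma[0,(M_x+\frac1\lambda)\xi,(t+\frac1\lambda)\xi]$ if $v_2<0<v_1$, $=\Gamma[0,(\frac x{v_1}+\frac1\lambda)\xi,(m_{x,t}+\frac1\lambda)\xi]$ if $0<v_2<v_1$;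 $\boldsymbol I(x,t)=\mathbb 1_{\{\min\{v_2t,0\}<x<v_1t\}}$. *)

(* Defs.v *)
From HB Require Import structures.
From mathcomp Require Import all_boot all_order all_algebra.
From mathcomp Require Import all_classical all_reals all_analysis.
Set Implicit Arguments. Unset Strict Implicit. Unset Printing Implicit Defensive.
Import Order.TTheory GRing.Theory Num.Theory.
Import numFieldNormedType.Exports.
Local Open Scope classical_set_scope.
Local Open Scope ring_scope.

Section Defs.
Variable R : realType.
Local Notation leb := (@lebesgue_measure R).

(* Generalized densities are represented as (signed-free, nonnegative) set
   functions on Borel sets of R: Dirac deltas become point masses, ordinary
   density terms become Lebesgue integrals over the set. *)

Definition p_gen (lam v1 v2 vj t : R) (A : set R) : \bar R :=
  (((1 + lam * t)^-1)%:E * \d_(vj * t)%R A +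
  (lam / ((v1 - v2) * (1 + lam * t)))%:E * leb (A `&` `](v2 * t)%R, (v1 * t)%R[))%E.

Definition ptilde_cond (lam xi v1 v2 vj t : R) (A : set R) : \bar R :=
  ((expR (- xi * t))%:E * p_gen lam v1 v2 vj t A +
  xi%:E * \int[leb]_(s in `[0%R, t]) ((expR (- xi * s))%:E * p_gen lam v1 v2 vj s A))%E.

Definition ptilde (lam xi v1 v2 q t : R) (A : set R) : \bar R :=
  (q%:E * ptilde_cond lam xi v1 v2 v1 t A + (1 - q)%:E * ptilde_cond lam xi v1 v2 v2 t A)%E.

Definition incGamma (a z0 z1 : R) : R :=
  Rintegral leb `[z0, z1] (fun s => s `^ (a - 1) * expR (- s)).

Definition Mx (v1 v2 x : R) : R := Num.max (x / v1) (x / v2).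
Definition mxt (v2 x t : R) : R := Num.min (x / v2) t.

Definition GammaLX (lam xi v1 v2 x t : R) : R :=
  if v2 < 0 then incGamma 0 ((Mx v1 v2 x + lam^-1) * xi) ((t + lam^-1) * xi)
  else incGamma 0 ((x / v1 + lam^-1) * xi) ((mxt v2 x t + lam^-1) * xi).

Definition Ind (v1 v2 x t : R) : R :=
  if (Num.min (v2 * t) 0 < x) && (x < v1 * t) then 1 else 0.

Definition H_ac (lam xi vj t x : R) : R :=
  Num.sg vj * (if (0 < x / vj) && (x / vj < t) then 1 else 0) *
  (xi * expR (- xi * x / vj) / (vj + lam * x)).

Definition H_gen (lam xi vj t : R) (A : set R) : \bar R :=
  ((expR (- xi * t) / (1 + lam * t))%:E * \d_(vj * t)%R A +
  \int[leb]_(x in A) (H_ac lam xi vj t x)%:E)%E.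

Definition rhs_gen (lam xi v1 v2 q t : R) (A : set R) : \bar R :=
  (q%:E * H_gen lam xi v1 t A + (1 - q)%:E * H_gen lam xi v2 t A +
  (lam * expR (- xi * t) / ((v1 - v2) * (1 + lam * t)))%:E
     * leb (A `&` `](v2 * t)%R, (v1 * t)%R[) +
  \int[leb]_(x in A)
     ((xi * expR (xi / lam) / (v1 - v2)) * Ind v1 v2 x t * GammaLX lam xi v1 v2 x t)%:E)%E.

End Defs.

(* Main.v *)
(* For a set A inside ]v2 t, v1 t[, the reset term is the time integral over
   [0, t] of the weight xi e^(-xi s) / (1 + lam s) against the law without resets.
   Its Dirac part at vj s becomes a density by the substitution x = vj s. Its
   uniform part is handled by Tonelli: the times s <= t with v2 s < x < v1 s form
   the interval ]Mx, t] (or ]x / v1, t] when v2 > 0), and the substitution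
   u = xi (s + 1/lam) turns the remaining integral of the weight into an
   incomplete Gamma function. *)
Require Import Defs.
From HB Require Import structures.
From mathcomp Require Import all_boot all_order all_algebra.
From mathcomp Require Import all_classical all_reals all_analysis.
From mathcomp Require Import ring measurable_realfun.
Import Order.TTheory GRing.Theory Num.Theory.
Import numFieldNormedType.Exports.
Local Open Scope classical_set_scope.
Local Open Scope ring_scope.

(** * Affine changes of variable for Lebesgue measure on the line *)

Lemma measurable_affine (R : realType) (v b : R) :
  measurable_fun [set: R] (fun x : R => v * x + b).
Proof. by apply: measurable_funD => //; exact: measurable_funM. Qed.

(** Uniqueness of Lebesgue measure: [|v|] times the pushforward under the affine map gives every
    half-open interval its length, hence is Lebesgue measure. *)
Lemma lebesgue_measure_affine (R : realType) (v b : R) (A : set R) :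
  v != 0 -> measurable A ->
  lebesgue_measure ((fun x : R => v * x + b) @^-1` A) =
  (`|v|^-1%:E * lebesgue_measure A)%E.
Proof.
move=> v0 mA.
have nv0 : (0 <= `|v|)%R by [].
suff -> : lebesgue_measure A =
    (`|v|%:E * lebesgue_measure ((fun x : R => (v * x + b)%R) @^-1` A))%E.
  by rewrite muleA -EFinM mulVf ?mul1e// normr_eq0.
have mphi := measurable_affine R v b.
(* lebesgue_measure lives on measurableTypeR R, whose display differs from that of R. *)
pose phi : {mfun (measurableTypeR R) >-> (measurableTypeR R)} :=
  HB.pack (fun x : R => v * x + b)
    (@isMeasurableFun.Build _ _ (measurableTypeR R) (measurableTypeR R) _ mphi).
apply: (@lebesgue_measure_unique R
  (mscale (NngNum nv0) (pushforward lebesgue_measure phi)) _ A mA) => X [[y z] _ <-] /=.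
transitivity (`|v|%:E *
  lebesgue_measure ((fun x : R => (v * x + b)%R) @^-1` `]y, z]%classic))%E; last by [].
have [vp|vn|ve] := ltgtP 0 v; last by rewrite -ve eqxx in v0.
- have -> : (fun x : R => v * x + b) @^-1` `]y, z]%classic =
      `](y - b) / v, (z - b) / v]%classic.
    apply/seteqP; split=> x /=; rewrite !in_itv/=;
    by rewrite ltr_pdivrMr// ler_pdivlMr// ltrBlDr lerBrDr mulrC.
  rewrite !lebesgue_measure_itv/= !lte_fin ltr_pM2r ?invr_gt0// ltrBlDr subrK.
  case: ifP => _; last by rewrite mule0.
  rewrite !EFinN -!EFinD -EFinM (gtr0_norm vp); congr EFin; field.
  by rewrite gt_eqF.
(* A negative slope swaps the endpoints, so the preimage is closed on the left and open on the
   right; its length is the same. *)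
- have -> : (fun x : R => v * x + b) @^-1` `]y, z]%classic =
      `[(z - b) / v, (y - b) / v[%classic.
    apply/seteqP; split=> x /=; rewrite !in_itv/=;
    by rewrite ltr_ndivlMr// ler_ndivrMr// ltrBlDr lerBrDr mulrC andbC.
  rewrite !lebesgue_measure_itv/= !lte_fin ltr_nM2r ?invr_lt0// ltrBlDr subrK.
  case: ifP => _; last by rewrite mule0.
  rewrite !EFinN -!EFinD -EFinM (ltr0_norm vn); congr EFin; field.
  by rewrite lt_eqF.
Qed.

(** The left side is the integral of [f] against the pushforward measure, which by the previous
    lemma is Lebesgue measure scaled by [|v|^-1]. *)
Lemma ge0_integral_affine (R : realType) (v b : R) (f : R -> \bar R) :
  v != 0 -> measurable_fun [set: R] f -> (forall x, 0 <= f x)%E ->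
  (\int[lebesgue_measure]_x f (v * x + b)%R =
   `|v|^-1%:E * \int[lebesgue_measure]_x f x)%E.
Proof.
move=> v0 mf f0.
have mphi := measurable_affine R v b.
have nv0 : (0 <= `|v|^-1)%R by rewrite invr_ge0.
pose phi : {mfun (measurableTypeR R) >-> (measurableTypeR R)} :=
  HB.pack (fun x : R => v * x + b)
    (@isMeasurableFun.Build _ _ (measurableTypeR R) (measurableTypeR R) _ mphi).
transitivity (\int[pushforward lebesgue_measure phi]_x f x)%E.
  by rewrite (@ge0_integral_pushforward _ _ (measurableTypeR R) (measurableTypeR R) R).
rewrite -(ge0_integral_mscale _ measurableT (NngNum nv0)) //.
by apply: eq_measure_integral => A mA _; exact: lebesgue_measure_affine.
Qed.

(** An atom moving at speed [v], averaged over time, has a density: the Dirac mass is the indicator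
    of [A] at [v * s], and the substitution x = v s brings the Jacobian [|v|^-1]. *)
Lemma integral_dirac_linear (R : realType) (v t : R) (g : R -> R) (A : set R) :
  v != 0 -> measurable A -> measurable_fun [set: R] g -> (forall s, 0 <= g s) ->
  (\int[lebesgue_measure]_(s in `[0%R, t]) ((g s)%:E * \d_(v * s)%R A) =
   \int[lebesgue_measure]_(x in A)
     (`|v|^-1 * (if (0 < x / v) && (x / v < t) then 1 else 0) * g (x / v))%:E)%E.
Proof.
move=> v0 mA mg g0.
have mlin : measurable_fun [set: R] (fun s : R => v * s) by exact: measurable_funM.
have mind : measurable_fun [set: R] (fun s : R => \1_A (v * s) : R).
  by apply: measurableT_comp.
pose f (s : R) : \bar R := (g s * \1_(`]0, t[%classic : set R) s * \1_A (v * s))%:E.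
have mf : measurable_fun [set: R] f.
  by apply/measurable_EFinP; apply: measurable_funM => //; apply: measurable_funM.
have f0 s : (0 <= f s)%E by rewrite lee_fin !mulr_ge0.
(* Dropping the null set of endpoints yields the strict inequalities of the right-hand side. *)
rewrite integral_itv_bndoo; last first.
  apply: measurable_funTS; apply: (eq_measurable_fun (fun s => (g s * \1_A (v * s))%:E)).
    by move=> s _; rewrite diracE EFinM indicE.
  by apply/measurable_EFinP; exact: measurable_funM.
transitivity (\int[lebesgue_measure]_s f s)%E.
  rewrite integral_mkcond; apply: eq_integral => s _.
  rewrite patchE /f indicE; case: ifP => _; last by rewrite mulr0 mul0r.
  by rewrite mulr1 diracE EFinM indicE.
transitivity (`|v|^-1%:E * \int[lebesgue_measure]_x f (v^-1 * x + 0)%R)%E.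
  rewrite (@ge0_integral_affine _ _ _ f) ?invr_eq0// normfV invrK muleA -EFinM.
  by rewrite mulVf ?normr_eq0// mul1e.
have mf' : measurable_fun [set: R] (fun x => f (v^-1 * x + 0)).
  by apply: (measurableT_comp mf); exact: measurable_affine.
rewrite -ge0_integralZl//.
rewrite [RHS]integral_mkcond; apply: eq_integral => x _.
rewrite patchE /f !indicE addr0 mulrA divff// mul1r (mulrC _ x).
have -> : (x / v \in (`]0, t[%classic : set R)) = (0 < x / v) && (x / v < t).
  by apply/idP/idP; rewrite inE /= in_itv.
case: ifP => xA; last by rewrite mulr0 mule0.
by rewrite mulr1 -EFinM; congr EFin; case: ifP => _ /=; ring.
Qed.

(** * Tonelli's theorem on the space-time cone *)

Section fubini_cone.
Variables (R : realType) (v1 v2 : R) (A : set R).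
Hypothesis mA : measurable A.

(** In a pair the first coordinate is time and the second is position. *)
Let cone : set (R * R) := [set z | A z.2] `&` [set z | v2 * z.1 < z.2 < v1 * z.1].

Let mcone : measurable cone.
Proof.
apply: measurableI.
  by rewrite -[X in measurable X]setTI;
  exact: (@measurable_snd _ _ R R measurableT _ mA).
rewrite -[X in measurable X]setTI.
suff m : measurable_fun [set: R * R]
    (fun z : R * R => v2 * z.1 < z.2 < v1 * z.1).
  exact: (m measurableT [set true] I).
by apply: measurable_and; apply: measurable_fun_ltr => //; apply: measurable_funM.
Qed.

Let coneE (s x : R) : (\1_cone (s, x) : R) = \1_(A `&` `](v2 * s), (v1 * s)[) x.
Proof.
by rewrite !indicE; congr (_%:R); congr nat_of_bool.
Qed.

Let coneE_time (s x : R) : A x ->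
  (\1_cone (s, x) : R) = \1_[set s | v2 * s < x < v1 * s] s.
Proof.
move=> Ax; rewrite !indicE; congr (_%:R); congr nat_of_bool.
by apply/idP/idP; rewrite !inE /cone/= => // -[].
Qed.

Let mlayer (s : R) : measurable (A `&` `](v2 * s), (v1 * s)[).
Proof. exact: measurableI. Qed.

(** The measure of a layer is the integral of the cone's indicator over position, and Tonelli makes
    such partial integrals measurable. *)
Lemma measurable_lebesgue_cone :
  measurable_fun [set: R]
    (fun s : R => lebesgue_measure (A `&` `](v2 * s), (v1 * s)[)).
Proof.
have mf : measurable_fun [set: R * R] (fun z : R * R => (\1_cone z)%:E : \bar R).
  by apply/measurable_EFinP.
have cone_ge0 (z : R * R) : (0 <= (\1_cone z)%:E :> \bar R)%E by rewrite lee_fin.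
have := @measurable_fun_fubini_tonelli_F _ _ (measurableTypeR R)
  (measurableTypeR R) R lebesgue_measure _ mf cone_ge0.
apply: eq_measurable_fun => s _; rewrite /fubini_F.
under eq_integral do rewrite coneE.
by rewrite (@integral_indic _ (measurableTypeR R) R _ _ measurableT _ (mlayer s)) setIT.
Qed.

(** Both sides are iterated integrals of the one function [f] on the plane, the weight [k] cut off
    to times in [0, t] and to the cone. *)
Lemma fubini_cone (k : R -> R) (t : R) :
  measurable_fun [set: R] k -> (forall s, 0 <= k s) ->
  (\int[lebesgue_measure]_(s in `[0%R, t])
     ((k s)%:E * lebesgue_measure (A `&` `](v2 * s)%R, (v1 * s)%R[)) =
   \int[lebesgue_measure]_(x in A)
     \int[lebesgue_measure]_(s in `[0%R, t] `&` [set s | (v2 * s < x < v1 * s)%R])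
       (k s)%:E)%E.
Proof.
move=> mk k0.
pose f (z : R * R) : \bar R := (k z.1 * \1_(`[0, t] : set R) z.1 * \1_cone z)%:E.
have mf : measurable_fun [set: R * R] f.
  apply/measurable_EFinP; apply: measurable_funM => //; apply: measurable_funM.
    exact: (measurableT_comp mk).
  by apply: measurableT_comp.
have f0 z : (0 <= f z)%E by rewrite lee_fin !mulr_ge0.
transitivity (\int[lebesgue_measure]_s \int[lebesgue_measure]_x f (s, x))%E.
  rewrite integral_mkcond; apply: eq_integral => s _.
  rewrite /f /= patchE indicE; case: ifP => _; last first.
    by rewrite integral0_eq// => x _; rewrite mulr0 mul0r.
  under eq_integral do rewrite mulr1 coneE EFinM.
  have mi : measurable_fun [set: R]
      (fun x : R => (\1_(A `&` `](v2 * s), (v1 * s)[) x)%:E : \bar R).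
    by apply/measurable_EFinP.
  rewrite (@ge0_integralZl _ (measurableTypeR R) R _ _ measurableT _ mi) ?lee_fin//.
  by rewrite (@integral_indic _ (measurableTypeR R) R _ _ measurableT _ (mlayer s)) setIT.
transitivity (\int[lebesgue_measure]_x \int[lebesgue_measure]_s f (s, x))%E.
  exact: (@fubini_tonelli _ _ (measurableTypeR R) (measurableTypeR R) R
    lebesgue_measure lebesgue_measure f mf f0).
rewrite [RHS]integral_mkcond; apply: eq_integral => x _.
rewrite patchE; case: ifP => [/set_mem xA|/negbT xA].
  rewrite [RHS]integral_mkcond; apply: eq_integral => s _.
  rewrite patchE /f /= coneE_time// !indicE in_setI.
  by case: (_ \in _); case: (_ \in _); rewrite /= ?mulr1 ?mulr0 ?mul0r.
rewrite integral0_eq// => s _; rewrite /f [X in _ * X]indicE memNset ?mulr0//=.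
by move=> [/= xA' _]; move/negP: xA; apply; rewrite inE.
Qed.

End fubini_cone.

(** * The damped weight and the incomplete Gamma function *)

(* The absolute value only serves to make the function nonnegative and
   measurable on the whole line; it is used for s >= 0. *)
Definition damped_rate {R : realType} (lam xi s : R) : R :=
  expR (- xi * s) / (1 + lam * `|s|).

Lemma damped_rate_ge0 (R : realType) (lam xi s : R) :
  0 <= lam -> 0 <= damped_rate lam xi s.
Proof. by move=> l0; rewrite divr_ge0 ?expR_ge0// addr_ge0// mulr_ge0. Qed.

Lemma measurable_damped_rate (R : realType) (lam xi : R) :
  0 <= lam -> measurable_fun [set: R] (damped_rate lam xi).
Proof.
move=> l0; apply: measurable_funM.
  by apply: measurableT_comp => //; exact: measurable_funM.
apply: continuous_measurable_fun => x.
apply: cvgV; first by rewrite gt_eqF// ltr_pwDl// mulr_ge0.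
apply: cvgD; first exact: cvg_cst.
by apply: cvgM; [exact: cvg_cst|exact: norm_continuous].
Qed.

(** [Rintegral] is the real part of an extended integral, so finiteness has to be shown; it holds
    because the singularity of 1/u at 0 lies outside [z0, z1]. *)
Lemma incGamma0E (R : realType) (z0 z1 : R) : 0 < z0 ->
  ((incGamma 0 z0 z1)%:E =
   \int[lebesgue_measure]_(u in `[z0, z1]) (u `^ (0 - 1) * expR (- u))%:E)%E.
Proof.
move=> z00; rewrite /incGamma fineK//.
have mf : measurable_fun [set: R] (fun u : R => u `^ (0 - 1) * expR (- u)).
  apply: measurable_funM; first exact: measurable_powR.
  by apply: measurableT_comp => //; exact: measurable_expR.
apply: integrable_fin_num => //.
apply: measurable_bounded_integrable => //.
- by rewrite /= lebesgue_measure_itv/=; case: ifP => _; rewrite ?ltry// -EFinD ltry.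
- exact: measurable_funTS.
(* On [z0, z1] one has 1/u <= 1/z0 and e^(-u) <= 1. *)
exists z0^-1; split; first exact: num_real.
move=> M zM u /=; rewrite in_itv/= => /andP[zu _].
have u0 : 0 < u by exact: lt_le_trans zu.
rewrite ger0_norm ?mulr_ge0 ?powR_ge0 ?expR_ge0//.
rewrite sub0r powR_inv1 ?(ltW u0)//; apply: le_trans (ltW zM).
rewrite -[leRHS]mulr1 ler_pM ?invr_ge0 ?expR_ge0 ?(ltW u0)//.
  by rewrite lef_pV2.
by rewrite expR_le1 oppr_le0 ltW.
Qed.

(** With u = xi (s + 1/lam) = (xi/lam)(1 + lam s), the measure e^(-u) du / u becomes lam e^(-xi/lam)
    e^(-xi s) ds / (1 + lam s). *)
Lemma integral_damped_rate (R : realType) (lam xi a b : R) :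
  0 < lam -> 0 < xi -> 0 <= a ->
  (\int[lebesgue_measure]_(s in `[a, b]) (damped_rate lam xi s)%:E =
   (lam^-1 * expR (xi / lam) *
      incGamma 0 ((a + lam^-1) * xi) ((b + lam^-1) * xi))%:E)%E.
Proof.
move=> l0 x0 a0; set z0 := (a + _) * _; set z1 := (b + _) * _.
have z00 : 0 < z0 by rewrite mulr_gt0// ltr_wpDl// invr_gt0.
pose F (u : R) : \bar R :=
  (\1_(`[z0, z1]%classic : set R) u * (u `^ (0 - 1) * expR (- u)))%:E.
have mF : measurable_fun [set: R] F.
  apply/measurable_EFinP; apply: measurable_funM => //.
  apply: measurable_funM; first exact: measurable_powR.
  by apply: measurableT_comp => //; exact: measurable_expR.
have F0 u : (0 <= F u)%E by rewrite lee_fin !mulr_ge0 ?powR_ge0 ?expR_ge0.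
have intF : ((incGamma 0 z0 z1)%:E = \int[lebesgue_measure]_u F u)%E.
  rewrite incGamma0E// integral_mkcond; apply: eq_integral => u _.
  by rewrite patchE /F indicE; case: ifP => _; rewrite ?mul1r ?mul0r.
have mFa : measurable_fun [set: R] (fun s => F (xi * s + xi / lam)).
  by apply: (measurableT_comp mF); exact: measurable_affine.
rewrite !EFinM intF.
have xi0 : xi != 0 by rewrite gt_eqF.
have -> : (\int[lebesgue_measure]_u F u =
    xi%:E * \int[lebesgue_measure]_s F (xi * s + xi / lam)%R)%E.
  rewrite (@ge0_integral_affine _ _ _ F)// gtr0_norm// muleA -EFinM divff//.
  by rewrite mul1e.
rewrite muleA -!EFinM.
rewrite -(@ge0_integralZl _ (measurableTypeR R) R _ _ measurableT _ mFa)//; last first.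
  by rewrite lee_fin !mulr_ge0 ?invr_ge0 ?expR_ge0 ?ltW.
rewrite [LHS]integral_mkcond; apply: eq_integral => s _.
rewrite patchE /F indicE.
have -> : (xi * s + xi / lam \in (`[z0, z1]%classic : set R)) =
    (s \in (`[a, b]%classic : set R)).
  rewrite /z0 /z1; apply/idP/idP; rewrite !inE /= !in_itv/=;
  by rewrite -mulrDr !(mulrC xi) !ler_pM2r// !lerD2r.
case: ifPn => [|_]; last by rewrite mul0r mule0.
rewrite inE/= in_itv/= => /andP[as_ _].
have s0 : 0 <= s by exact: le_trans as_.
rewrite mul1r -EFinM; congr EFin.
have u0 : 0 <= xi * s + xi / lam.
  by rewrite addr_ge0 // ?divr_ge0 ?mulr_ge0 // ltW.
rewrite sub0r powR_inv1// opprD expRD /damped_rate ger0_norm// mulNr.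
rewrite [expR (- (xi / lam))]expRN.
have := expR_gt0 (xi / lam); set e := expR (xi / lam) => e0.
have q0 : 0 < 1 + lam * s by rewrite ltr_wpDr// mulr_ge0// ltW.
have -> : xi * s + xi / lam = xi / lam * (1 + lam * s) by field; rewrite gt_eqF.
by field; rewrite xi0 !gt_eqF.
Qed.

(** * The times at which a given position lies in the cone *)

Section time_slice.
Variables (R : realType) (lam xi v1 v2 t x : R).
Hypotheses (lam0 : 0 < lam) (xi0 : 0 < xi) (t0 : 0 < t).
Hypothesis (v12 : (v2 < 0 < v1) \/ (0 < v2 < v1)).
Hypothesis (xt : v2 * t < x < v1 * t).

(** The time from which the spreading interval ]v2 s, v1 s[ covers [x]. *)
Let start := if v2 < 0 then Mx v1 v2 x else x / v1.

Let start_ge0 : 0 <= start.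
Proof.
rewrite /start; case: v12 => /andP[v20 v10].
  (* Since v2 < 0 < v1, one of x / v1 and x / v2 is nonnegative, depending on the sign of [x]. *)
  rewrite v20 /Mx le_max; have [x0|x0] := leP 0 x.
    by rewrite divr_ge0// ltW.
  by rewrite [X in _ || X]mulr_le0 ?orbT ?invr_le0 ?ltW.
have v1_gt0 := lt_trans v20 v10.
rewrite (lt_gtF v20) divr_ge0 ?(ltW v1_gt0)//.
by case/andP: xt => + _; move/ltW; apply: le_trans; rewrite mulr_ge0// ltW.
Qed.

Let slice : (`[0, t] `&` [set s | v2 * s < x < v1 * s])%classic =
  `]start, t]%classic.
Proof.
have /andP[x2 x1] := xt.
apply/seteqP; split=> s /=; rewrite !in_itv/=.
  move=> [/andP[s0 st] /andP[xs2 xs1]]; rewrite st andbT /start.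
  case: v12 => /andP[v20 v10].
    by rewrite v20 /Mx gt_max ltr_pdivrMr// mulrC xs1 ltr_ndivrMr// mulrC.
  by rewrite (lt_gtF v20) ltr_pdivrMr ?(lt_trans v20)// mulrC.
move=> /andP[ss st]; split.
  by rewrite st andbT (le_trans start_ge0)// ltW.
move: ss; rewrite /start; case: v12 => /andP[v20 v10].
  rewrite v20 /Mx gt_max ltr_pdivrMr// ltr_ndivrMr// => /andP[? ?].
  by rewrite !(mulrC _ s); apply/andP.
rewrite (lt_gtF v20) ltr_pdivrMr ?(lt_trans v20)// mulrC => ->.
(* For v2 > 0 the lower bound follows from v2 s <= v2 t < x. *)
by rewrite andbT; apply: le_lt_trans x2; rewrite ler_pM2l.
Qed.

Lemma measurable_slice :
  measurable (`[0, t] `&` [set s | v2 * s < x < v1 * s]).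
Proof. by rewrite slice. Qed.

Lemma integral_damped_rate_slice :
  (\int[lebesgue_measure]_(s in `[0%R, t] `&` [set s | (v2 * s < x < v1 * s)%R])
     (damped_rate lam xi s)%:E =
   (lam^-1 * expR (xi / lam) * GammaLX lam xi v1 v2 x t)%:E)%E.
Proof.
rewrite slice integral_itv_obnd_cbnd; last first.
  apply: measurable_funTS; apply/measurable_EFinP.
  by apply: measurable_damped_rate; exact: ltW.
rewrite integral_damped_rate// /GammaLX /start; case: ifPn => // v20.
case: v12 => /andP[v2s v1s]; first by rewrite v2s in v20.
(* For v2 > 0, v2 t < x gives t < x / v2, so the minimum is [t]. *)
rewrite /mxt (min_idPr _)// ler_pdivlMr//.
by case/andP: xt => /ltW + _; rewrite mulrC.
Qed.

End time_slice.

(** * The reset term and the density for a fixed initial velocity *)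

Section resetting.
Variables (R : realType) (lam xi v1 v2 t : R) (A : set R).
Hypotheses (lam0 : 0 < lam) (xi0 : 0 < xi) (v21 : v2 < v1) (t0 : 0 < t).
Hypothesis v12 : (v2 < 0 < v1) \/ (0 < v2 < v1).
Hypotheses (mA : measurable A) (At : A `<=` `](v2 * t), (v1 * t)[).

Let k := damped_rate lam xi.
Let k0 s : 0 <= k s. Proof. by apply: damped_rate_ge0; exact: ltW. Qed.
Let mk : measurable_fun [set: R] k.
Proof. by apply: measurable_damped_rate; exact: ltW. Qed.

(** The sign in [H_ac] comes from the Jacobian, [|vj|^-1 = sg vj / vj], and its denominator from vj
    (1 + lam x / vj) = vj + lam x. *)
Lemma integral_reset_dirac (vj : R) : vj != 0 ->
  (\int[lebesgue_measure]_(s in `[0%R, t]) ((xi * k s)%:E * \d_(vj * s)%R A) =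
   \int[lebesgue_measure]_(x in A) (H_ac lam xi vj t x)%:E)%E.
Proof.
move=> vj0; rewrite integral_dirac_linear//; last 2 first.
  exact: measurable_funM.
  by move=> s; rewrite mulr_ge0// ltW.
apply: eq_integral => x _; congr EFin; rewrite /H_ac /k /damped_rate.
case: ifPn => [/andP[xv xvt]|_]; last by rewrite !(mulr0, mul0r).
have q0 : 0 < 1 + lam * (x / vj) by rewrite ltr_wpDr// mulr_ge0// ltW.
have -> : `|vj|^-1 = Num.sg vj / vj.
  have [vp|vn|ve] := ltgtP 0 vj; last by rewrite -ve eqxx in vj0.
    by rewrite gtr0_norm// gtr0_sg// mul1r.
  by rewrite ltr0_norm// ltr0_sg// invrN mulN1r.
rewrite (gtr0_norm xv) !mulr1 -(mulrA (- xi) x).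
have nz : vj + lam * x != 0.
  have -> : vj + lam * x = vj * (1 + lam * (x / vj)) by field.
  by rewrite mulf_neq0// gt_eqF.
by field; rewrite vj0 nz.
Qed.

(** After Tonelli the inner integral is the time-slice integral of the weight; its factor 1/lam
    cancels the lam of the uniform density. *)
Lemma integral_reset_cone :
  (\int[lebesgue_measure]_(s in `[0%R, t])
     ((xi * (lam / (v1 - v2)) * k s)%:E *
      lebesgue_measure (A `&` `](v2 * s)%R, (v1 * s)%R[)) =
   \int[lebesgue_measure]_(x in A)
     ((xi * expR (xi / lam) / (v1 - v2)) * Ind v1 v2 x t *
      GammaLX lam xi v1 v2 x t)%:E)%E.
Proof.
have c0 : 0 <= xi * (lam / (v1 - v2)) by rewrite mulr_ge0 ?divr_ge0 ?subr_ge0 ?ltW.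
rewrite fubini_cone//; last 2 first.
  exact: measurable_funM.
  by move=> s; rewrite mulr_ge0.
apply: eq_integral => x /set_mem /At /=; rewrite in_itv/= => xt.
have mkE (D : set R) : measurable_fun D (fun s => (k s)%:E : \bar R).
  by apply: measurable_funTS; exact/measurable_EFinP.
under eq_integral do rewrite EFinM.
have mslice := measurable_slice _ _ _ _ _ t0 v12 xt.
rewrite (@ge0_integralZl _ (measurableTypeR R) R _ _ mslice _ (mkE _))//; last first.
  by move=> s _; rewrite lee_fin.
rewrite integral_damped_rate_slice// -EFinM; congr EFin.
have -> : Ind v1 v2 x t = 1.
  by case/andP: xt => x2 x1; rewrite /Ind gt_min x2 x1.
field.
by rewrite subr_eq0 !gt_eqF.
Qed.

(** The reset integrand splits into a moving atom [f1] and a uniform layer [f2], each evaluated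
    above. The term without resets supplies the Dirac mass of [H_gen] and the uniform density at
    time t. *)
Lemma ptilde_condE (vj : R) : vj != 0 ->
  (ptilde_cond lam xi v1 v2 vj t A =
   H_gen lam xi vj t A +
   ((lam * expR (- xi * t) / ((v1 - v2) * (1 + lam * t)))%:E
     * lebesgue_measure (A `&` `](v2 * t)%R, (v1 * t)%R[) +
   \int[lebesgue_measure]_(x in A)
     ((xi * expR (xi / lam) / (v1 - v2)) * Ind v1 v2 x t *
      GammaLX lam xi v1 v2 x t)%:E))%E.
Proof.
move=> vj0.
pose f1 s : \bar R := ((xi * k s)%:E * \d_(vj * s)%R A)%E.
pose f2 s : \bar R := ((xi * (lam / (v1 - v2)) * k s)%:E *
  lebesgue_measure (A `&` `](v2 * s)%R, (v1 * s)%R[))%E.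
have c0 : 0 <= lam / (v1 - v2) by rewrite divr_ge0 ?subr_ge0// ltW.
have xi_ge0 := ltW xi0.
have f10 s : (0 <= f1 s)%E by rewrite mule_ge0// lee_fin mulr_ge0.
have f20 s : (0 <= f2 s)%E.
  by apply: mule_ge0; [rewrite lee_fin mulr_ge0// mulr_ge0|exact: measure_ge0].
have mf1 : measurable_fun [set: R] f1.
  apply: emeasurable_funM.
    by apply/measurable_EFinP; exact: measurable_funM.
  apply: (eq_measurable_fun (fun s => (\1_A (vj * s))%:E)).
    by move=> s _; rewrite diracE indicE.
  by apply/measurable_EFinP; apply: measurableT_comp => //; exact: measurable_funM.
have mf2 : measurable_fun [set: R] f2.
  apply: emeasurable_funM; last exact: measurable_lebesgue_cone.
  by apply/measurable_EFinP; exact: measurable_funM.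
have mf : measurable_fun `[0, t]%classic (fun s => f1 s + f2 s)%E.
  by apply: measurable_funTS; exact: emeasurable_funD.
have reset_term : (xi%:E * \int[lebesgue_measure]_(s in `[0%R, t])
      ((expR (- xi * s))%:E * p_gen lam v1 v2 vj s A) =
    \int[lebesgue_measure]_(s in `[0%R, t]) (f1 s + f2 s))%E.
  (* The factor 1/xi is moved inside the integral of [f1 + f2], whose measurability is [mf]; the
     integrands are then compared pointwise. *)
  transitivity (xi%:E * (xi^-1%:E *
      \int[lebesgue_measure]_(s in `[0%R, t]) (f1 s + f2 s)))%E; last first.
    by rewrite muleA -EFinM divff ?gt_eqF// mul1e.
  congr (_ * _)%E.
  rewrite -(@ge0_integralZl _ (measurableTypeR R) R _ _ _ _ mf)//; last 2 first.
    by move=> s _; rewrite adde_ge0.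
    by rewrite lee_fin invr_ge0 ltW.
  apply: eq_integral => s; rewrite inE/= in_itv/= => /andP[s0 st].
  have q0 : 0 < 1 + lam * s by rewrite ltr_wpDr// mulr_ge0// ltW.
  rewrite (ge0_muleDr _ (f10 s) (f20 s)) /p_gen.
  rewrite ge0_muleDr ?mule_ge0//; last 2 first.
    by rewrite lee_fin invr_ge0 ltW.
    by rewrite lee_fin invfM mulrA mulr_ge0// invr_ge0 ltW.
  rewrite /f1 /f2 !muleA -!EFinM /k /damped_rate ger0_norm//.
  by congr (_%:E + _%:E * _)%E; field; rewrite ?subr_eq0 !gt_eqF.
have t1 : 0 < 1 + lam * t by rewrite ltr_wpDr// mulr_ge0// ltW.
rewrite /ptilde_cond reset_term.
rewrite (@ge0_integralD _ (measurableTypeR R) R)//; last 2 first.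
  exact: measurable_funTS mf1.
  exact: measurable_funTS mf2.
rewrite integral_reset_dirac// integral_reset_cone /H_gen /p_gen.
rewrite ge0_muleDr ?mule_ge0//; last 2 first.
  by rewrite lee_fin invr_ge0 ltW.
  by rewrite lee_fin invfM mulrA mulr_ge0// invr_ge0 ltW.
rewrite !muleA -!EFinM addeACA; congr (_ + _ + (_%:E * _ + _))%E.
by field; rewrite subr_eq0 !gt_eqF.
Qed.

End resetting.

(** * Averaging over the random initial velocity *)

Theorem theorem3 (R : realType) (lam xi v1 v2 q t : R) :
  0 < lam -> 0 < xi -> v2 < v1 ->
  (v2 < 0 < v1) \/ (0 < v2 < v1) ->
  0 <= q <= 1 -> 0 < t ->
  forall A : set R, measurable A -> A `<=` `](v2 * t), (v1 * t)[ ->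
    ptilde lam xi v1 v2 q t A = rhs_gen lam xi v1 v2 q t A.
Proof.
move=> lam0 xi0 v21 v12 /andP[q0 q1] t0 A mA At.
have v10 : v1 != 0
  by case: v12 => /andP[? ?]; rewrite gt_eqF//; apply: lt_trans v21.
have v20 : v2 != 0
  by case: v12 => /andP[? ?]; [rewrite lt_eqF|rewrite gt_eqF].
rewrite /ptilde /rhs_gen !ptilde_condE//.
set H1 := H_gen _ _ _ _ _; set H2 := H_gen _ _ _ _ _.
set B := (_%:E * lebesgue_measure _)%E; set G := (X in _ = (_ + X)%E).
have one_lamt_gt0 : 0 < 1 + lam * t by rewrite ltr_wpDr// mulr_ge0// ltW.
have Hge0 (vj : R) : vj != 0 -> (0 <= H_gen lam xi vj t A)%E.
  move=> vj0; apply: adde_ge0.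
    by rewrite mule_ge0// lee_fin divr_ge0 ?expR_ge0// ltW.
  (* The formula for the density does not show its sign; the reset integral that it equals has a
     nonnegative integrand. The same device serves for [G] below. *)
  rewrite -integral_reset_dirac//; apply: integral_ge0 => s _.
  by rewrite mule_ge0// lee_fin mulr_ge0 ?damped_rate_ge0// ltW.
have BG0 : (0 <= B + G)%E.
  apply: adde_ge0.
    apply: mule_ge0; last exact: measure_ge0.
    by rewrite lee_fin divr_ge0 ?mulr_ge0 ?expR_ge0 ?subr_ge0// ltW.
  rewrite /G -integral_reset_cone//; apply: integral_ge0 => s _.
  apply: mule_ge0; last exact: measure_ge0.
  rewrite lee_fin mulr_ge0 ?damped_rate_ge0 ?(ltW lam0)//.
  by rewrite mulr_ge0 ?divr_ge0 ?subr_ge0// ltW.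
(* Distributivity in the extended reals rests on these signs; the common part [B + G] then has total
   weight q + (1 - q) = 1. *)
rewrite (ge0_muleDr q%:E (Hge0 _ v10) BG0).
rewrite (ge0_muleDr (1 - q)%:E (Hge0 _ v20) BG0).
rewrite addeACA -(@ge0_muleDl _ (B + G)%E q%:E) ?lee_fin ?subr_ge0//.
by rewrite -EFinD subrKC mul1e addeA.
Qed.
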